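(* Consider a tabular policy in a discrete state-action space, any meta-parameter $\phi$, and the within-task algorithm $\mathcal Alg$ defined, for every $s\in\mathcal S$, by $$\mathcal Alg(\pi_\phi,\lambda,\tau)(\cdot|s)=\operatorname*{argmax}_{\pi(\cdot|s)}\ \sum_{a\in\mathcal A}\pi(a|s)Q_\tau^{\pi_\phi}(s,a)-\lambda d^2(\pi_\phi(\cdot|s),\pi(\cdot|s))\quad\text{subject to }\sum_{a}\pi(a|s)=1.$$ Let $\pi_{\theta'_\tau}=\mathcal Alg(\pi_\phi,\lambda,\tau)$. If $M(s)=\lambda\nabla^2_{\pi(\cdot|s)}d^2(\pi_\phi(\cdot|s),\pi(\cdot|s))\big|_{\pi=\pi_{\theta'_\tau}}$ is non-singular for each $s\in\mathcal S$, then $$\nabla_\phi J_\tau(\pi_{\theta'_\tau})=\frac{1}{1-\gamma}\mathbb E_{s\sim\nu_\tau^{\pi_{\theta'_\tau}}}\Big[\sum_{a\in\mathcal A}\nabla_\phi\pi_{\theta'_\tau}(a|s)\,Q_\tau^{\pi_{\theta'_\tau}}(s,a)\Big],$$ where $$\nabla_\phi^\top\pi_{\theta'_\tau}(\cdot|s)=\Big(M(s)^{-1}-\frac{M(s)^{-1}\mathbf 1\mathbf 1^\top M(s)^{-1}}{\mathbf 1^\top M(s)^{-1}\mathbf 1}\Big)\Big(\nabla_\phi^\top Q_\tau^{\pi_\phi}(s,\cdot)-\lambda\nabla_\phi^\top\nabla_{\pi(\cdot|s)}d^2(\pi_\phi(\cdot|s),\pi(\cdot|s))\Big)\Big|_{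\pi=\pi_{\theta'_\tau}}.$$
   Context: The task $\tau$ is an MDP $(\mathcal S,\mathcal A,\gamma,\rho_\tau,P_\tau,r_\tau)$ with discount $\gamma\in(0,1)$, initial distribution $\rho_\tau$, transition probability $P_\tau$ and reward $r_\tau$ with values in $[0,r_{max}]$. For a policy $\pi$, $V_\tau^\pi(s)=\mathbb E[\sum_{t\ge0}\gamma^tr_\tau(s_t,a_t,s_{t+1})|s_0=s,\pi]$, $Q_\tau^\pi(s,a)$ is the same with also $a_0=a$, $J_\tau(\pi)=\mathbb E_{s\sim\rho_\tau}[V_\tau^\pi(s)]$, and $\nu_\tau^\pi(s)=(1-\gamma)\sum_{t\ge0}\gamma^t\mathbb P(s_t=s|\pi,s_0\sim\rho_\tau)$. A tabular policy is one whose action distributions $\pi(\cdot|s)$ at different states are independent of each other; $\pi_\phi$ is a (differentiable) parametrization of policies by $\phi$. $d(\cdot,\cdot)$ is a chosen distance between action distributions (e.g. $d^2(p,q)=D_{KL}(p\|q)$ or $D_{KL}(q\|p)$), and $\lambda>0$. For a vector-valued function $g$ of $\phi$, $\nabla_\phi^\top g$ denotes its Jacobian with rows indexed by the components of $g$; $\pi(\cdot|s)$ and $Q_\tau^{\pi_\phi}(s,\cdot)$ are regarded as vectors indexed by $a\in\mathcal A$; $\mathbf 1$ is the all-ones vector.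
   Formalization: Added: d² is lower semicontinuous (else the argmax can jump in φ and the gradient fails to exist), d² is jointly smooth at the maximizer so the second derivatives exist, and 1ᵀM(s)⁻¹1 ≠ 0; S and A are finite, and the argmax is assumed unique and a policy. *)

(* Defs.v *)
From HB Require Import structures.
From mathcomp Require Import all_boot all_order all_algebra.
From mathcomp Require Import all_classical all_reals all_analysis.

Set Implicit Arguments.
Unset Strict Implicit.
Unset Printing Implicit Defensive.

Import Order.TTheory GRing.Theory Num.Theory.
Import numFieldNormedType.Exports.

Local Open Scope classical_set_scope.
Local Open Scope ring_scope.

Section calculus.
Context {R : realType}.

Definition grad n (f : 'rV[R]_n -> R) (x : 'rV[R]_n) : 'rV[R]_n :=
  \row_j 'D_(delta_mx 0 j) f x.

(* The Jacobian with rows indexed by the components of [g]; the library's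
   ['J g x] acts on row vectors from the right, hence the transpose. *)
Definition jac n m (g : 'rV[R]_n -> 'rV[R]_m) (x : 'rV[R]_n) : 'M[R]_(m, n) :=
  ('J g x)^T.

Definition hess n (f : 'rV[R]_n -> R) (x : 'rV[R]_n) : 'M[R]_n :=
  jac (grad f) x.

Definition argmax T (C : set T) (F : T -> \bar R) : set T :=
  [set x | C x /\ forall y, C y -> (F y <= F x)%E].

Definition is_dist (T : finType) (p : T -> R) : Prop :=
  (forall x, 0 <= p x) /\ \sum_x p x = 1.

End calculus.

(* The action set is {0, ..., k-1}, so that vectors indexed by actions are row
   vectors and matrices indexed by actions are square matrices. *)
Record mdp (R : realType) (S : finType) (k : nat) := Mdp {
  gamma : R;
  rho : S -> R;
  trans : S -> 'I_k -> S -> R;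
  rew : S -> 'I_k -> S -> R;
  rmax : R;
  gamma_bounds : 0 < gamma < 1;
  rho_dist : is_dist rho;
  trans_dist : forall s a, is_dist (trans s a);
  rew_bounds : forall s a s', 0 <= rew s a s' <= rmax }.

(* A table with one action vector [pi s] for each state [s]. *)
Definition table (R : realType) (S : finType) (k : nat) := S -> 'rV[R]_k.

Definition is_policy (R : realType) (S : finType) (k : nat)
  (pi : table R S k) : Prop := forall s, is_dist (pi s 0).

(* Probability that the state-action pairs at times 0, ..., n are
   h 0, ..., h n, when the pair at time 0 is drawn from [kappa] and then
   s_{t+1} ~ trans s_t a_t, a_{t+1} ~ pi s_{t+1}. *)
Definition path_prob (R : realType) (S : finType) (k : nat) (M : mdp R S k)
    (kappa : S * 'I_k -> R) (pi : table R S k) (n : nat)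
    (h : nat -> S * 'I_k) : R :=
  kappa (h 0%N) *
  \prod_(t < n) (trans M (h t).1 (h t).2 (h t.+1).1 *
                 pi (h t.+1).1 0 (h t.+1).2).

(* State-action trajectories of the MDP, realized on a measurable space [Omega]
   that carries one probability for each initial law [kappa] and policy [pi];
   by the Ionescu-Tulcea theorem, (S * 'I_k)^nat with its coordinate maps is
   such a space. *)
Record trajectories (R : realType) (S : finType) (k : nat) (M : mdp R S k)
    (disp : measure_display) (Omega : measurableType disp) := Trajectories {
  step : nat -> Omega -> S * 'I_k;
  law : (S * 'I_k -> R) -> table R S k -> probability Omega R;
  measurable_step : forall t x, measurable (step t @^-1` [set x]);
  lawE : forall kappa pi, is_dist kappa -> is_policy pi -> forall n h,
    law kappa pi [set w | forall t, (t <= n)%N -> step t w = h t] =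
    (path_prob M kappa pi n h)%:E }.

Section values.
Context {R : realType} {S : finType} {k : nat} {M : mdp R S k}.
Context {disp : measure_display} {Omega : measurableType disp}.
Variable Z : trajectories M Omega.
Implicit Types (pi : table R S k) (s : S) (a : 'I_k).

Definition return_ (w : Omega) : R :=
  limn (series (fun t => gamma M ^+ t *
    rew M (step Z t w).1 (step Z t w).2 (step Z t.+1 w).1)).

Definition V pi s : R :=
  fine 'E_(law Z (fun x => (x.1 == s)%:R * pi s 0 x.2) pi)[return_].

Definition Q pi s : 'rV[R]_k :=
  \row_a fine 'E_(law Z (fun x => (x == (s, a))%:R) pi)[return_].

Definition J pi : R := \sum_s rho M s * V pi s.

Definition visit pi s : R :=
  (1 - gamma M) * limn (series (fun t => gamma M ^+ t *
    fine (law Z (fun x => rho M x.1 * pi x.1 0 x.2) pi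
            [set w | (step Z t w).1 = s]))).

End values.

Section within_task.
Context {R : realType} {S : finType} {k : nat} {M : mdp R S k}.
Context {disp : measure_display} {Omega : measurableType disp}.
Variable Z : trajectories M Omega.

(* [dsq q p] is d^2(q, p).  Differentiating in [p] as a vector requires [dsq] on
   a neighborhood of the distributions, so it is given on all vectors; the value
   +oo marks arguments that are not admissible (such as, for the
   Kullback-Leibler divergence, vectors with a negative entry). *)
Variable dsq : 'rV[R]_k -> 'rV[R]_k -> \bar R.

Definition objective (lambda : R) (pi : table R S k) (s : S) (p : 'rV[R]_k) :
    \bar R :=
  ((\sum_a p 0 a * Q Z pi s 0 a)%:E - lambda%:E * dsq (pi s) p)%E.

Definition sum_one : set 'rV[R]_k := [set p | \sum_a p 0 a = 1].

Variables (m : nat) (pol : 'rV[R]_m -> table R S k) (s : S).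

Definition dsq_param (phi : 'rV[R]_m) (p : 'rV[R]_k) : R :=
  fine (dsq (pol phi s) p).

(* Smoothness of (phi, p) |-> d^2(pi_phi(.|s), p) at a point: in p only it is
   differentiable nearby, and its gradient in p is jointly differentiable at the
   point, so that both the Hessian in p and the mixed second derivative in
   (phi, p) exist there. *)
Record twice_differentiable_at (phi : 'rV[R]_m) (p : 'rV[R]_k) : Prop := {
  dsq_finite_near : \forall x \near (phi, p), dsq (pol x.1 s) x.2 \is a fin_num;
  dsq_continuous : {for (phi, p),
    continuous (fun x : 'rV[R]_m * 'rV[R]_k => dsq_param x.1 x.2)};
  dsq_differentiable_near :
    \forall x \near (phi, p), differentiable (dsq_param x.1) x.2;
  grad_dsq_differentiable : differentiable
    (fun x : 'rV[R]_m * 'rV[R]_k => grad (dsq_param x.1) x.2) (phi, p) }.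

End within_task.

Definition ones {R : realType} k : 'cV[R]_k := const_mx 1.

Definition ones_form {R : realType} k (M : 'M[R]_k) : R :=
  ((ones k)^T *m invmx M *m ones k) 0 0.

(* The Schur-complement form of the p-block of the inverse of the bordered
   matrix [M 1; 1^T 0]; division by zero returns a default value here, so it is
   meaningful only when [ones_form M != 0]. *)
Definition constrained_inv {R : realType} k (M : 'M[R]_k) : 'M[R]_k :=
  invmx M -
  (ones_form M)^-1 *: (invmx M *m ones k *m (ones k)^T *m invmx M).

(* Main.v *)
(* The value functions are handled through the resolvent of the finite Markov
   chain of state-action pairs: Q and the discounted visitation are resolvents
   applied to the mean reward and to state indicators, and the performance
   difference Q^pi' - Q^pi (or J(pi') - J(pi)) is a fixed linear combination of
   the advantages sum_a (pi'(a|s) - pi(a|s)) Q^pi'(s,a).  Each summand is a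
   product of a differentiable factor vanishing at pi and of a continuous one, so
   differentiability of Q and the policy gradient need no series to be
   differentiated.

   The solution of the inner problem is continuous in phi by compactness of the
   simplex, lower semicontinuity of d^2 and uniqueness of the argmax.  Its
   first-order condition says that Q - lambda grad d^2 is a multiple of the
   all-ones vector; the constrained inverse N of M annihilates that vector and
   satisfies N M v = v on vectors v of zero sum, so applying N to the linearized
   condition isolates the increment of the solution. *)
Require Import Defs.
From HB Require Import structures.
From mathcomp Require Import all_boot all_order all_algebra.
From mathcomp Require Import all_classical all_reals all_analysis.
From mathcomp Require Import measurable_realfun ring lra.
Set Implicit Arguments.
Unset Strict Implicit.
Unset Printing Implicit Defensive.
Import Order.TTheory GRing.Theory Num.Theory.
Import numFieldNormedType.Exports.
Local Open Scope classical_set_scope.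
Local Open Scope ring_scope.

(** * Resolvents of finite Markov chains *)

Section resolvent.
Context {R : realType} {X : finType}.
Variables (g : R) (K : X -> X -> R).

Definition kernel_op (f : X -> R) : X -> R := fun x => \sum_y K x y * f y.

(** The Neumann series of [(1 - g K)^-1] applied to [f]. *)
Definition resolvent (f : X -> R) (x : X) : R :=
  limn (series (fun t => g ^+ t * iter t kernel_op f x)).

Hypothesis K_dist : forall x, is_dist (K x).
Hypothesis g01 : 0 < g < 1.

Lemma kernel_op_le f B : (forall x, `|f x| <= B) ->
  forall x, `|kernel_op f x| <= B.
Proof.
move=> fB x; have [K0 K1] := K_dist x.
rewrite -(mul1r B) -K1 mulr_suml; apply: (le_trans (ler_norm_sum _ _ _)).
by apply: ler_sum => y _; rewrite normrM ger0_norm// ler_wpM2l.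
Qed.

Lemma kernel_opB f h x :
  kernel_op (fun y => f y - h y) x = kernel_op f x - kernel_op h x.
Proof. by rewrite /kernel_op -sumrB; apply: eq_bigr => y _; rewrite mulrBr. Qed.

Lemma iter_kernel_op_le f B t : (forall x, `|f x| <= B) ->
  forall x, `|iter t kernel_op f x| <= B.
Proof. by move=> fB; elim: t => // t IH x /=; exact: kernel_op_le. Qed.

Lemma sup_bound (f : X -> R) x : `|f x| <= \sum_y `|f y|.
Proof. by rewrite (bigD1 x)//= lerDl sumr_ge0. Qed.

(** Iterates of a stochastic kernel obey every uniform bound on [f], so a geometric series
    dominates; on the finite set [X] the sum of all [|f y|] is such a bound. *)
Lemma is_cvg_resolvent f x :
  cvgn (series (fun t => g ^+ t * iter t kernel_op f x)).
Proof.
have [g0 g1] := andP g01.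
have bound t : `|g ^+ t * iter t kernel_op f x| <= (\sum_y `|f y|) * g ^+ t.
  rewrite normrM ger0_norm ?exprn_ge0 ?(ltW g0)// mulrC.
  rewrite ler_wpM2r ?exprn_ge0 ?(ltW g0)//.
  by apply: iter_kernel_op_le => y; exact: sup_bound.
apply: (@normed_cvg R R); apply: (@series_le_cvg _ _
  (fun t => (\sum_y `|f y|) * g ^+ t)) => [t|t|t|].
- exact: normr_ge0.
- by rewrite mulr_ge0 ?sumr_ge0// exprn_ge0// ltW.
- exact: bound.
- by apply: is_cvg_geometric_series; rewrite gtr0_norm.
Qed.

Lemma resolvent_fix f x :
  resolvent f x = f x + g * kernel_op (resolvent f) x.
Proof.
(* After a shift of the index, the term of index 0 splits off and the remaining partial sum is [g]
   times the kernel applied to the previous partial sums; the finite sum over [y] then passes to the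
   limit. *)
rewrite {1}/resolvent; apply: cvg_lim => //; rewrite -cvg_shiftS.
rewrite (_ : (fun _ => _) = (fun n => f x + g * \sum_y K x y *
    series (fun t => g ^+ t * iter t kernel_op f y) n)).
  apply: cvgD; first exact: cvg_cst.
  apply: cvgM; first exact: cvg_cst.
  apply: cvg_big => [|y _]; first exact: add_continuous.
  apply: cvgM; first exact: cvg_cst.
  exact: is_cvg_resolvent.
apply/funext => n; rewrite /series /= big_nat_recl//= expr0 mul1r; congr (_ + _).
under [in RHS]eq_bigr do rewrite mulr_sumr.
rewrite exchange_big /= mulr_sumr; apply: eq_bigr => t _.
rewrite exprS -mulrA; congr (_ * _); rewrite mulr_sumr.
by apply: eq_bigr => y _; rewrite mulrCA.
Qed.

(** Maximum principle: at a point [x0] where [|f|] is largest, averaging by [K] cannot exceed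
    [|f x0|], whence [(1 - g) |f x0| <= B]. *)
Lemma fix_le f h B : (forall x, f x = h x + g * kernel_op f x) ->
  (forall x, `|h x| <= B) -> forall x, `|f x| <= B / (1 - g).
Proof.
have [g0 g1] := andP g01.
move=> fE hB x; have [x0 _ x0max] := @arg_maxP _ _ _ x xpredT (fun y => `|f y|) isT.
apply: (le_trans (x0max x isT)); rewrite /= ler_pdivlMr ?subr_gt0//.
have : `|f x0| <= B + g * `|f x0|.
  rewrite {1}fE (le_trans (ler_normD _ _))// lerD// normrM gtr0_norm//.
  by rewrite ler_pM2l// kernel_op_le// => y; exact: x0max.
by rewrite mulrBr mulr1 mulrC; lra.
Qed.

(** The difference of two solutions solves the homogeneous equation, and [fix_le] with [B = 0] makes
    it vanish. *)
Lemma resolvent_unique f u : (forall x, u x = f x + g * kernel_op u x) ->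
  forall x, u x = resolvent f x.
Proof.
move=> uE x; apply/eqP; rewrite -subr_eq0 -normr_le0.
have := @fix_le (fun x => u x - resolvent f x) (fun=> 0) 0 _ _ x; rewrite mul0r.
apply=> [y|y]; last by rewrite normr0.
by rewrite kernel_opB uE resolvent_fix; ring.
Qed.

(** Linearity comes from uniqueness: the right-hand side solves the fixed-point equation of the
    left. *)
Lemma resolvent_sum (I : finType) (c : I -> R) (F : I -> X -> R) x :
  resolvent (fun y => \sum_i c i * F i y) x = \sum_i c i * resolvent (F i) x.
Proof.
rewrite -(@resolvent_unique _ (fun y => \sum_i c i * resolvent (F i) y))// => {}x.
rewrite /kernel_op; under [X in _ = _ + _ * X]eq_bigr do rewrite mulr_sumr.
rewrite exchange_big /= mulr_sumr -big_split /=; apply: eq_bigr => i _.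
rewrite resolvent_fix mulrDr mulrCA /kernel_op !mulr_sumr; congr (_ + _).
by apply: eq_bigr => y _; ring.
Qed.

End resolvent.

(** * Expectations along trajectories *)

Section trajectories.
Context {R : realType} {S : finType} {k : nat} (M : mdp R S k).
Implicit Types (pi : table R S k) (kappa : S * 'I_k -> R).

Definition pi_kernel pi (x y : S * 'I_k) : R :=
  trans M x.1 x.2 y.1 * pi y.1 0 y.2.

Definition mean_rew (x : S * 'I_k) : R :=
  \sum_s trans M x.1 x.2 s * rew M x.1 x.2 s.

Lemma sum_pair (F : S -> 'I_k -> R) :
  \sum_x F x.1 x.2 = \sum_s \sum_a F s a.
Proof. by rewrite pair_bigA. Qed.

Lemma sum_policy pi : is_policy pi -> forall F : S -> R,
  \sum_(x : S * 'I_k) F x.1 * pi x.1 0 x.2 = \sum_s F s.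
Proof.
move=> pip F; rewrite (sum_pair (fun s a => F s * pi s 0 a)).
by apply: eq_bigr => s _; rewrite -mulr_sumr (pip s).2 mulr1.
Qed.

Lemma is_dist_joint pi (p : S -> R) : is_policy pi -> is_dist p ->
  is_dist (fun x => p x.1 * pi x.1 0 x.2).
Proof.
move=> pip [p0 p1]; split=> [x|]; first by rewrite mulr_ge0// (pip _).1.
by rewrite sum_policy.
Qed.

Lemma is_dist_kernel pi : is_policy pi -> forall x, is_dist (pi_kernel pi x).
Proof. by move=> pip x; apply: is_dist_joint => //; exact: trans_dist. Qed.

Lemma is_dist_dirac (T : finType) (y : T) : is_dist (fun x => (x == y)%:R : R).
Proof.
split=> [x|]; first exact: ler0n.
by rewrite (bigD1 y)//= eqxx big1 ?addr0// => x /negPf ->.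
Qed.

Context {disp : measure_display} {Omega : measurableType disp}.
Variable Z : trajectories M Omega.

(** The cylinders, whose probabilities [lawE] prescribes. *)
Definition prefix (n : nat) (h : nat -> S * 'I_k) : set Omega :=
  [set w | forall t, (t <= n)%N -> step Z t w = h t].

(** Only the values up to time [n.+1] matter: [extend h n z] is used in cylinders of that length. *)
Definition extend (h : nat -> S * 'I_k) (n : nat) (z : S * 'I_k) (t : nat) :=
  if (t <= n)%N then h t else z.

Lemma measurable_prefix n h : measurable (prefix n h).
Proof.
rewrite (_ : prefix n h =
    \bigcap_(t in [set t | (t <= n)%N]) step Z t @^-1` [set h t])//.
by apply: bigcap_measurable => [|t _]; [exists 0%N|exact: measurable_step].
Qed.

(** Since [Y] is finite, every preimage is a finite union of fibres of [u]. *)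
Lemma measurable_finite_comp (Y : finType) (u : Omega -> Y) (F : Y -> R) :
  (forall y, measurable (u @^-1` [set y])) -> measurable_fun setT (F \o u).
Proof.
move=> mu _ B _; rewrite setTI.
rewrite (_ : _ @^-1` B = \bigcup_(y in [set y | B (F y)]) u @^-1` [set y]).
  by apply: fin_bigcup_measurable => //; exact: finite_finset.
by apply/seteqP; split=> [w Bw|w [y By /= wy]]; [exists (u w)|rewrite /= wy].
Qed.

Lemma measurable_reward t : measurable_fun setT
  (fun w => rew M (step Z t w).1 (step Z t w).2 (step Z t.+1 w).1).
Proof.
apply: (@measurable_finite_comp _ (fun w => (step Z t w, step Z t.+1 w))
  (fun x => rew M x.1.1 x.1.2 x.2.1)) => -[y z].
rewrite (_ : _ @^-1` _ = step Z t @^-1` [set y] `&` step Z t.+1 @^-1` [set z]).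
  by apply: measurableI; exact: measurable_step.
by apply/seteqP; split=> w /= [-> ->].
Qed.

Lemma reward_ge0 t w : 0 <= rew M (step Z t w).1 (step Z t w).2 (step Z t.+1 w).1.
Proof. by case/andP: (rew_bounds M (step Z t w).1 (step Z t w).2 (step Z t.+1 w).1). Qed.

Lemma prefix_extend n h :
  prefix n h = \big[setU/set0]_(z <- enum {: S * 'I_k}) prefix n.+1 (extend h n z).
Proof.
rewrite -bigcup_seq; apply/seteqP; split=> [w hw|w [z _ hw] t tn].
  exists (step Z n.+1 w); first by rewrite /= mem_enum.
  move=> t; rewrite /extend leq_eqVlt => /predU1P[->|]; first by rewrite ltnn.
  by rewrite ltnS => tn; rewrite tn hw.
by rewrite hw 1?leqW// /extend tn.
Qed.

Lemma setT_prefix : setT = \big[setU/set0]_(z <- enum {: S * 'I_k}) prefix 0 (cst z).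
Proof.
rewrite -bigcup_seq; apply/seteqP; split=> // w _.
by exists (step Z 0 w); rewrite /= ?mem_enum// => t; rewrite leqn0 => /eqP ->.
Qed.

Local Open Scope ereal_scope.

Lemma integral_prefix_extend (P : probability Omega R) (f : Omega -> \bar R) n h :
    measurable_fun setT f -> (forall w, 0 <= f w) ->
  \int[P]_(w in prefix n h) f w =
  \sum_z \int[P]_(w in prefix n.+1 (extend h n z)) f w.
Proof.
move=> mf f0; rewrite prefix_extend ge0_integral_bigsetU ?big_enum//=.
- by move=> z; exact: measurable_prefix.
- exact: enum_uniq.
- move=> x y _ _ [w [/(_ n.+1 (leqnn _)) wx /(_ n.+1 (leqnn _))]].
  by rewrite wx /extend ltnn.
- exact: measurable_funTS.
Qed.

Lemma integral_prefix0 (P : probability Omega R) (f : Omega -> \bar R) :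
    measurable_fun setT f -> (forall w, 0 <= f w) ->
  \int[P]_w f w = \sum_z \int[P]_(w in prefix 0 (cst z)) f w.
Proof.
move=> mf f0; rewrite setT_prefix ge0_integral_bigsetU ?big_enum//=.
- by move=> z; exact: measurable_prefix.
- exact: enum_uniq.
- by move=> x y _ _ [w [/(_ 0%N (leqnn _)) wx /(_ 0%N (leqnn _))]]; rewrite wx.
- exact: measurable_funTS.
Qed.

Section expectations.
Variables (kappa : S * 'I_k -> R) (pi : table R S k).
Hypothesis kappa_dist : is_dist kappa.
Hypothesis pi_policy : is_policy pi.

Let P := law Z kappa pi.
Let K := pi_kernel pi.

Lemma path_prob_extend n h z : path_prob M kappa pi n.+1 (extend h n z) =
  (path_prob M kappa pi n h * K (h n) z)%R.
Proof.
rewrite /path_prob big_ord_recr /= -!mulrA /extend leqnn ltnn; congr (_ * (_ * _))%R.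
by apply: eq_bigr => t _; rewrite ltn_ord ltnW.
Qed.

Lemma integral_prefix_cst (f : Omega -> \bar R) n h (c : R) :
    (forall w, prefix n h w -> f w = c%:E) ->
  \int[P]_(w in prefix n h) f w = (path_prob M kappa pi n h * c)%:E.
Proof.
move=> fc; rewrite (eq_integral (cst c%:E)); last first.
  by move=> w; rewrite inE => /fc.
rewrite integral_cst; last exact: measurable_prefix.
by rewrite [X in _ * X]lawE// -EFinM mulrC.
Qed.

Section markov.
Variables (G : nat -> Omega -> \bar R) (f : S * 'I_k -> R).
Hypothesis mG : forall n, measurable_fun setT (G n).
Hypothesis G0 : forall n w, 0 <= G n w.
Hypothesis Gf : forall n h,
  \int[P]_(w in prefix n h) G n w = (path_prob M kappa pi n h * f (h n))%:E.

(** By [Gf], [f] is the conditional expectation of [G n] given the pairs up to time [n]. Splitting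
    the cylinder by the next pair trades one unit of [j] for one of [n], at the price of one factor
    of the kernel. *)
Lemma integral_prefix j n h : \int[P]_(w in prefix n h) G (n + j)%N w =
  (path_prob M kappa pi n h * iter j (kernel_op K) f (h n))%:E.
Proof.
elim: j n h => [|j IH] n h; first by rewrite addn0 Gf.
rewrite integral_prefix_extend// addnS -addSn.
under eq_bigr do rewrite IH path_prob_extend /extend ltnn -mulrA.
by rewrite sumEFin -mulr_sumr.
Qed.

Lemma integral_step j :
  \int[P]_w G j w = (\sum_x kappa x * iter j (kernel_op K) f x)%R%:E.
Proof.
rewrite integral_prefix0// -sumEFin; apply: eq_bigr => z _.
by rewrite -[j]add0n integral_prefix /path_prob big_ord0 mulr1.
Qed.

End markov.

Lemma law_state s t : fine (P [set w | (step Z t w).1 = s]) =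
  (\sum_x kappa x * iter t (kernel_op K) (fun x => (x.1 == s)%:R) x)%R.
Proof.
pose G t (w : Omega) : \bar R := (((step Z t w).1 == s)%:R)%:E.
have mG n : measurable_fun setT (G n).
  apply/measurable_EFinP; apply: (@measurable_finite_comp _ (step Z n)
    (fun x => (x.1 == s)%:R)) => y; exact: measurable_step.
rewrite -[RHS]/(fine (_%:E)) -(@integral_step G)//.
- congr fine; rewrite -[X in P X]setIT -integral_indic//; last first.
    rewrite (_ : [set w | _] =
        \bigcup_(x in [set x : S * 'I_k | x.1 = s]) step Z t @^-1` [set x]).
      apply: fin_bigcup_measurable => [|x _]; first exact: finite_finset.
      exact: measurable_step.
    by apply/seteqP; split=> [w ws|w [x /= <- ->]//]; exists (step Z t w).
  apply: eq_integral => w _; rewrite /G indicE.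
  rewrite (_ : (w \in _) = ((step Z t w).1 == s))//.
  by apply/idP/eqP; rewrite inE.
- by move=> n w; rewrite lee_fin.
- by move=> n h; apply: integral_prefix_cst => w /(_ n (leqnn _)) hn; rewrite /G hn.
Qed.

Lemma integral_reward t :
  \int[P]_w (rew M (step Z t w).1 (step Z t w).2 (step Z t.+1 w).1)%:E =
  (\sum_x kappa x * iter t (kernel_op K) mean_rew x)%R%:E.
Proof.
pose G t (w : Omega) : \bar R :=
  (rew M (step Z t w).1 (step Z t w).2 (step Z t.+1 w).1)%:E.
have mG n : measurable_fun setT (G n).
  by apply/measurable_EFinP; exact: measurable_reward.
have G0 n w : 0 <= G n w by rewrite lee_fin reward_ge0.
rewrite -(@integral_step G)// => n h.
(* The reward at time [n] also depends on the state at time [n.+1], so the cylinder is split once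
   more; averaging over that state produces [mean_rew]. *)
rewrite integral_prefix_extend//.
under eq_bigr => z _.
  rewrite (@integral_prefix_cst _ _ _ (rew M (h n).1 (h n).2 z.1)).
    rewrite path_prob_extend -mulrA; over.
  move=> w hw; rewrite /G hw ?leqnSn// hw// /extend leqnn ltnn; reflexivity.
rewrite sumEFin -mulr_sumr; congr (_ * _)%:E.
rewrite /mean_rew -(sum_policy pi_policy); apply: eq_bigr => z _.
by rewrite /K /pi_kernel mulrAC.
Qed.

End expectations.
End trajectories.

(** * Performance differences *)

Section policy_values.
Context {R : realType} {S : finType} {k : nat} {M : mdp R S k}.
Context {disp : measure_display} {Omega : measurableType disp}.
Variable Z : trajectories M Omega.
Implicit Types (pi : table R S k) (kappa : S * 'I_k -> R) (x : S * 'I_k).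

Let D pi := resolvent (gamma M) (pi_kernel M pi).
Let r := mean_rew M.

Lemma limn_resolvent kappa pi (f : S * 'I_k -> R) : is_policy pi ->
  series (fun t => gamma M ^+ t *
    \sum_x kappa x * iter t (kernel_op (pi_kernel M pi)) f x) @ \oo -->
  \sum_x kappa x * D pi f x.
Proof.
move=> pip; rewrite (_ : series _ = fun n => \sum_x kappa x *
    series (fun t => gamma M ^+ t * iter t (kernel_op (pi_kernel M pi)) f x) n).
  apply: cvg_big => [|x _]; first exact: add_continuous.
  apply: cvgM; first exact: cvg_cst.
  apply: is_cvg_resolvent; [exact: is_dist_kernel|exact: gamma_bounds].
apply/funext => n; rewrite /series /=.
under [RHS]eq_bigr do rewrite mulr_sumr.
rewrite exchange_big /=; apply: eq_bigr => t _; rewrite mulr_sumr.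
by apply: eq_bigr => x _; rewrite mulrCA.
Qed.

Lemma is_cvg_return w : cvgn (series (fun t => gamma M ^+ t *
    rew M (step Z t w).1 (step Z t w).2 (step Z t.+1 w).1)).
Proof.
have [g0 g1] := andP (gamma_bounds M).
apply: (@series_le_cvg _ _ (fun t => rmax M * gamma M ^+ t)) => [t|t|t|].
- have /andP[r0 _] := rew_bounds M (step Z t w).1 (step Z t w).2 (step Z t.+1 w).1.
  by rewrite mulr_ge0// exprn_ge0// ltW.
- have /andP[r0 r1] := rew_bounds M (step Z t w).1 (step Z t w).2 (step Z t.+1 w).1.
  by rewrite mulr_ge0 ?(le_trans r0 r1)// exprn_ge0// ltW.
- have /andP[r0 r1] := rew_bounds M (step Z t w).1 (step Z t w).2 (step Z t.+1 w).1.
  by rewrite mulrC ler_wpM2r// exprn_ge0// ltW.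
- by apply: is_cvg_geometric_series; rewrite gtr0_norm.
Qed.

(** Rewards are nonnegative, so monotone convergence exchanges expectation and discounted series,
    with no integrability to check. *)
Lemma expectation_return kappa pi : is_dist kappa -> is_policy pi ->
  ('E_(law Z kappa pi)[return_ Z] = (\sum_x kappa x * D pi r x)%:E)%E.
Proof.
move=> kd pip; have [g0 g1] := andP (gamma_bounds M).
pose R_ t w := rew M (step Z t w).1 (step Z t w).2 (step Z t.+1 w).1.
have R_ge0 t w : 0 <= gamma M ^+ t * R_ t w.
  by rewrite mulr_ge0 ?reward_ge0// exprn_ge0// ltW.
have mR_ t : measurable_fun setT (R_ t) by exact: measurable_reward.
have limE (u : nat -> R) : cvgn (series u) ->
    (\sum_(0 <= t <oo) (u t)%:E = (limn (series u))%:E)%E.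
  by move=> cu; rewrite -EFin_lim//; congr (limn _); apply/funext => n /=; rewrite sumEFin.
rewrite unlock (eq_integral (fun w =>
    \sum_(0 <= t <oo) (gamma M ^+ t * R_ t w)%:E)%E); last first.
  by move=> w _; rewrite limE//; exact: is_cvg_return.
rewrite integral_nneseries//; first last.
- by move=> t w _; rewrite lee_fin.
- by move=> t; apply/measurable_EFinP; exact: measurable_funM.
rewrite (eq_eseriesr (fun t _ => _ : _ = (gamma M ^+ t *
    \sum_x kappa x * iter t (kernel_op (pi_kernel M pi)) r x)%:E)).
  rewrite limE; last first.
    by apply/cvg_ex; exists (\sum_x kappa x * D pi r x); exact: limn_resolvent.
  by congr EFin; apply: cvg_lim => //; exact: limn_resolvent.
move=> t _; rewrite EFinM -(integral_reward Z)//.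
under eq_integral do rewrite EFinM.
rewrite ge0_integralZl_EFin ?exprn_ge0 1?ltW//.
- by move=> w _; rewrite lee_fin reward_ge0.
- exact/measurable_EFinP.
Qed.

Lemma QE pi s a : is_policy pi -> Q Z pi s 0 a = D pi r (s, a).
Proof.
move=> pip; rewrite mxE expectation_return//=; last exact: is_dist_dirac.
rewrite (bigD1 (s, a))//= eqxx mul1r big1 ?addr0// => x /negPf ->.
by rewrite mul0r.
Qed.

Lemma VE pi s : is_policy pi -> V Z pi s = \sum_a pi s 0 a * D pi r (s, a).
Proof.
move=> pip; rewrite /V expectation_return//=; last first.
  (* Where [x.1] differs from [s] the weight is zero, so [pi s] may be replaced by [pi x.1], which
     is the form of [is_dist_joint]. *)
  rewrite (_ : (fun x => _) = fun x : S * 'I_k => (x.1 == s)%:R * pi x.1 0 x.2).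
    exact: (is_dist_joint pip (is_dist_dirac s)).
  by apply/funext => x; have [->|] := eqVneq x.1 s; rewrite ?mul0r.
rewrite (eq_bigr (fun x => (x.1 == s)%:R * (pi x.1 0 x.2 * D pi r (x.1, x.2)))).
  rewrite (sum_pair (fun s' a => (s' == s)%:R * (pi s' 0 a * D pi r (s', a)))).
  rewrite (bigD1 s)//= [X in _ + X]big1 ?addr0 => [|s' /negPf ->].
    by apply: eq_bigr => a _; rewrite eqxx mul1r.
  by rewrite big1// => a _; rewrite mul0r.
by case=> s' a _ /=; have [->|] := eqVneq s' s; rewrite ?mul0r// mulrA.
Qed.

Lemma JE pi : is_policy pi ->
  J Z pi = \sum_x rho M x.1 * pi x.1 0 x.2 * D pi r x.
Proof.
move=> pip; rewrite (eq_bigr (fun x => rho M x.1 * pi x.1 0 x.2 * D pi r (x.1, x.2))).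
  rewrite (sum_pair (fun s a => rho M s * pi s 0 a * D pi r (s, a))).
  apply: eq_bigr => s _; rewrite VE// mulr_sumr.
  by apply: eq_bigr => a _; rewrite mulrA.
by case.
Qed.

Lemma visitE pi s : is_policy pi -> visit Z pi s = (1 - gamma M) *
  \sum_x rho M x.1 * pi x.1 0 x.2 * D pi (fun x => (x.1 == s)%:R) x.
Proof.
move=> pip; congr (_ * _); apply: cvg_lim => //.
rewrite (_ : (fun t => _) = fun t => gamma M ^+ t *
    \sum_x rho M x.1 * pi x.1 0 x.2 *
      iter t (kernel_op (pi_kernel M pi)) (fun x => (x.1 == s)%:R) x).
  exact: (@limn_resolvent (fun x => rho M x.1 * pi x.1 0 x.2) pi _ pip).
apply/funext => t; rewrite law_state//.
exact: (is_dist_joint pip (rho_dist M)).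
Qed.

(** The action value is that of the second policy. In the difference formulas below the visitation
    weights are then those of the first one, hence constant when only the second varies. *)
Definition advantage pi pi' s : R :=
  \sum_a (pi' s 0 a - pi s 0 a) * Q Z pi' s 0 a.

(** Decomposing [h] into state indicators makes the visitation weights appear. *)
Lemma resolvent_state pi (h : S -> R) x : is_policy pi ->
  D pi (fun x => h x.1) x = \sum_s h s * D pi (fun x => (x.1 == s)%:R) x.
Proof.
move=> pip; rewrite /D -resolvent_sum; last 2 first.
- exact: is_dist_kernel.
- exact: gamma_bounds.
congr (resolvent _ _ _ x); apply/funext => y.
rewrite (bigD1 y.1)//= eqxx mulr1 big1 ?addr0// => s.
by rewrite eq_sym => /negPf ->; rewrite mulr0.
Qed.

Lemma sum_advantage (p : S -> R) pi pi' : is_policy pi' ->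
  \sum_s p s * advantage pi pi' s =
  \sum_x p x.1 * ((pi' x.1 0 x.2 - pi x.1 0 x.2) * D pi' r x).
Proof.
move=> pip'; rewrite [RHS](eq_bigr (fun x => p x.1 *
  ((pi' x.1 0 x.2 - pi x.1 0 x.2) * D pi' r (x.1, x.2)))); last by case.
rewrite (sum_pair (fun s a => p s * ((pi' s 0 a - pi s 0 a) * D pi' r (s, a)))).
apply: eq_bigr => s _; rewrite /advantage mulr_sumr.
by apply: eq_bigr => a _; rewrite QE.
Qed.

(* The value difference plus the advantage solves the same Bellman equation as
   the resolvent of the advantage. *)
Lemma value_difference pi pi' x : is_policy pi -> is_policy pi' ->
  D pi' r x - D pi r x =
  D pi (fun x => advantage pi pi' x.1) x - advantage pi pi' x.1.
Proof.
move=> pip pip'; pose h x := advantage pi pi' x.1.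
have Dfix p f y : is_policy p ->
    D p f y = f y + gamma M * kernel_op (pi_kernel M p) (D p f) y.
  by move=> pp; apply: resolvent_fix; [exact: is_dist_kernel|exact: gamma_bounds].
apply/eqP; rewrite eq_sym subr_eq; apply/eqP/esym.
pose u y := D pi' r y - D pi r y + h y.
apply: (@resolvent_unique _ _ _ _ (is_dist_kernel M pip) (gamma_bounds M) h u).
move=> y; rewrite /u.
rewrite [D pi' r y]Dfix// [D pi r y]Dfix// addrC; congr (_ + _).
rewrite opprD addrACA subrr add0r -mulrBr; congr (_ * _).
rewrite /kernel_op -sumrB.
pose t s := trans M y.1 y.2 s.
rewrite [RHS](_ : _ = \sum_z (pi_kernel M pi y z * (D pi' r z - D pi r z) +
    t z.1 * advantage pi pi' z.1 * pi z.1 0 z.2)); last first.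
  by apply: eq_bigr => z _; rewrite /pi_kernel /h /t; ring.
rewrite [in RHS]big_split /=.
rewrite [X in _ = _ + X](sum_policy pip (fun s => t s * advantage pi pi' s)).
rewrite sum_advantage// -big_split /=; apply: eq_bigr => z _.
by rewrite /pi_kernel /t; ring.
Qed.

(** The coefficient of [s'] is the expected discounted number of visits to [s'] from time 1 on: at
    time 0 the action is prescribed, so no advantage is collected there. *)
Lemma Q_difference pi pi' s a : is_policy pi -> is_policy pi' ->
  Q Z pi' s 0 a - Q Z pi s 0 a = \sum_s'
    (D pi (fun x => (x.1 == s')%:R) (s, a) - (s == s')%:R) * advantage pi pi' s'.
Proof.
move=> pip pip'; rewrite !QE// value_difference// resolvent_state//.
under [in RHS]eq_bigr do rewrite mulrBl.
rewrite sumrB; congr (_ - _); first by apply: eq_bigr => s' _; rewrite mulrC.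
rewrite (bigD1 s)//= eqxx mul1r big1 ?addr0// => s'.
by rewrite eq_sym => /negPf ->; rewrite mul0r.
Qed.

(** The performance difference lemma. Here the initial action is drawn from the policy as well, and
    the change of its law restores the time-0 advantage that [value_difference] subtracts. *)
Lemma J_difference pi pi' : is_policy pi -> is_policy pi' ->
  J Z pi' - J Z pi =
  (1 - gamma M)^-1 * \sum_s visit Z pi s * advantage pi pi' s.
Proof.
move=> pip pip'; have [_ g1] := andP (gamma_bounds M).
have -> : (1 - gamma M)^-1 * \sum_s visit Z pi s * advantage pi pi' s =
    \sum_x rho M x.1 * pi x.1 0 x.2 * D pi (fun x => advantage pi pi' x.1) x.
  rewrite mulr_sumr (eq_bigr (fun s => \sum_x rho M x.1 * pi x.1 0 x.2 *
      (advantage pi pi' s * D pi (fun x => (x.1 == s)%:R) x))).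
    by rewrite exchange_big; apply: eq_bigr => x _; rewrite resolvent_state// mulr_sumr.
  move=> s _; rewrite visitE// -mulrA mulKf ?subr_eq0 ?gt_eqF//.
  by rewrite mulr_suml; apply: eq_bigr => x _; rewrite mulrAC mulrA.
rewrite [RHS](_ : _ = \sum_x (rho M x.1 * pi x.1 0 x.2 * (D pi' r x - D pi r x) +
    rho M x.1 * advantage pi pi' x.1 * pi x.1 0 x.2)); last first.
  by apply: eq_bigr => x _; rewrite value_difference//; ring.
rewrite [in RHS]big_split /=.
rewrite [X in _ = _ + X](sum_policy pip (fun s => rho M s * advantage pi pi' s)).
rewrite sum_advantage// !JE// -sumrB -big_split /=; apply: eq_bigr => x _; ring.
Qed.

Lemma Q_bound pi s a : is_policy pi ->
  `|Q Z pi s 0 a| <= rmax M / (1 - gamma M).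
Proof.
move=> pip; rewrite QE//.
apply: (fix_le (is_dist_kernel M pip) (gamma_bounds M) (h := r)) => [x|x].
  by apply: resolvent_fix; [exact: is_dist_kernel|exact: gamma_bounds].
have [t0 t1] := trans_dist M x.1 x.2.
rewrite -[rmax M]mul1r -t1 mulr_suml (le_trans (ler_norm_sum _ _ _))//.
apply: ler_sum => s' _; have /andP[r0 r1] := rew_bounds M x.1 x.2 s'.
by rewrite ger0_norm ?mulr_ge0// ler_wpM2l.
Qed.

End policy_values.

(** * Pointwise differentiability *)

Section differentiation.
Context {R : realType}.

Lemma diff_eps (V W : normedModType R) (f : V -> W) x : differentiable f x ->
  forall e, 0 < e -> \forall y \near x,
    `|f y - f x - 'd f x (y - x)| <= e * `|y - x|.
Proof.
move=> /diff_locally/eqaddoP fx e e0; have := fx e e0.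
rewrite [in X in _ -> X](near_shift 0) /= => /filterS; apply => h /=.
by rewrite /= subr0 addrK opprD addrA.
Qed.

Lemma is_diff_eps (V W : normedModType R) (f : V -> W) x (df : {linear V -> W}) :
    continuous df ->
    (forall e, 0 < e -> \forall y \near x,
       `|f y - f x - df (y - x)| <= e * `|y - x|) ->
  is_diff x f df.
Proof.
move=> dfc fe; have fE : f \o shift x = cst (f x) + df +o_ 0 id.
  apply/eqaddoP => e e0; have := fe e e0.
  rewrite [in X in X -> _](near_shift 0) /= => /filterS; apply => h /=.
  by rewrite /= subr0 addrK opprD addrA.
have dfE := diff_unique dfc fE.
by apply: DiffDef => //; apply/diff_locallyP; rewrite dfE.
Qed.

Lemma diff_lipschitz (V W : normedModType R) (f : V -> W) x :
    differentiable f x ->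
  exists2 C, 0 < C & \forall y \near x, `|f y - f x| <= C * `|y - x|.
Proof.
move=> fx; have [C C0 dfC] := linear_lipschitz (diff_continuous fx).
exists (1 + C); first by rewrite addr_gt0.
have := diff_eps fx ltr01; apply: filterS => y; rewrite mul1r => H.
rewrite -[f y - f x](subrK ('d f x (y - x))) (le_trans (ler_normD _ _))//.
by rewrite mulrDl mul1r lerD.
Qed.

(** Replacing [q] by the constant [q x] costs [u y * (q y - q x)], which is [O(|y - x|)] times
    [o(1)]; no differentiability of [q] enters. *)
Lemma is_diff_mul0 (V : normedModType R) (u q : V -> R) x :
    differentiable u x -> u x = 0 -> {for x, continuous q} ->
  is_diff x (u * q) (q x *: ('d u x : V -> R)).
Proof.
move=> du u0 cq; pose w := fun y => u y * (q y - q x).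
have uqE : u * q = q x *: u + w.
  by apply/funext => y; rewrite !fctE /w /GRing.scale /=; ring.
have [C C0 uC] := diff_lipschitz du.
have dw : is_diff x w 0.
  apply: (@is_diff_eps _ _ w x \0%R); first exact: cst_continuous.
  move=> e e0; near=> y; rewrite /w u0 mul0r !subr0 normrM.
  have uy : `|u y| <= C * `|y - x|.
    by have : `|u y - u x| <= C * `|y - x|; [near: y | rewrite u0 subr0].
  have qy : `|q y - q x| <= e / C.
    rewrite distrC ltW//; near: y; move/cvgrPdist_lt : cq; apply.
    by rewrite divr_gt0.
  rewrite (le_trans (ler_pM _ _ uy qy))//.
  by rewrite mulrC mulrA divfK ?gt_eqF.
rewrite uqE; have duP := differentiableP du.
apply: is_diff_eq; by rewrite addr0.
Unshelve. all: by end_near. Qed.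

Lemma is_diff_sum (V W : normedModType R) (I : finType) (f df : I -> V -> W) x :
    (forall i, is_diff x (f i) (df i)) ->
  is_diff x (\sum_i f i) (\sum_i df i).
Proof.
move=> H; elim/big_ind2 : _ => [|f1 g1 f2 g2 H1 H2|i _]; last exact: H.
- exact: is_diff_cst.
- exact: is_diffD.
Qed.

Lemma continuous_coord_rV k (v : 'rV[R]_k) a :
  {for v, continuous (fun w : 'rV[R]_k => w 0 a)}.
Proof. exact/differentiable_continuous/differentiable_coord. Qed.

Lemma differentiable_rV (V : normedModType R) k (f : V -> 'rV[R]_k) x :
  (forall a, differentiable (fun y => f y 0 a) x) -> differentiable f x.
Proof.
move=> df; rewrite (_ : f = \sum_a (fun y => f y 0 a *: delta_mx 0 a)).
  apply: differentiable_sum => a.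
  exact: (differentiableZl (k := fun y => f y 0 a) _ (df a)).
by apply/funext => y; rewrite fct_sumE [LHS]row_sum_delta.
Qed.

Lemma differentiable_comp_coord (V : normedModType R) k (f : V -> 'rV[R]_k) x a :
  differentiable f x -> differentiable (fun y => f y 0 a) x.
Proof.
move=> df.
apply: (@differentiable_comp _ _ _ _ f (fun w => w 0 a) x df).
exact: differentiable_coord.
Qed.

(* Continuity of [p] is assumed, so differentiability of [U] at the single point
   suffices, unlike in the implicit function theorem. *)
Lemma implicit_is_diff (X Y W : normedModType R) (p : X -> Y) (U : X * Y -> W)
    (N : {linear W -> Y}) x :
    continuous N -> {for x, continuous p} -> differentiable U (x, p x) ->
    (\forall y \near x, N (U (y, p y)) = N (U (x, p x))) ->
    (\forall y \near x,
       N ('d U (x, p x) (0, p y - p x)) = - (p y - p x)) ->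
  is_diff x p (fun v => N ('d U (x, p x) (v, 0))).
Proof.
move=> cN cp dU NU NdU; set L := fun v => _.
have Ladd : linear L.
  move=> a u v; rewrite /L -linearP -linearP; congr (N ('d U _ _)).
  by congr pair; rewrite /= scaler0 addr0.
pose L' : {linear X -> Y} := HB.pack L (GRing.isLinear.Build _ _ _ _ L Ladd).
have cL : continuous L'.
  move=> v; apply: (@continuous_comp _ _ _ (fun v : X => (v, 0 : Y)) (N \o 'd U (x, p x))).
    by apply: cvg_pair; [exact: cvg_id|exact: cvg_cst].
  apply: continuous_comp; first exact: diff_continuous.
  exact: cN.
apply: (@is_diff_eps _ _ p x L') => //.
have [C C0 NC] := linear_lipschitz cN.
have [K K0 LK] := linear_lipschitz cL.
have cxp : (y, p y) @[y --> x] --> (x, p x).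
  by apply: cvg_pair; [exact: cvg_id|exact: cp].
(* The remainder is first controlled by both increments; the increment of [p] is absorbed
   afterwards. *)
have key c : 0 < c -> \forall y \near x,
    `|p y - p x - L (y - x)| <= c * (`|y - x| + `|p y - p x|).
  move=> c0; have c0' : 0 < c / C by rewrite divr_gt0.
  near=> y.
  (* This is [N] applied to the first-order remainder of [U]: the increment of [U] is killed by [N],
     and the part of the differential along [p y - p x] is sent to its opposite. *)
  have -> : p y - p x - L (y - x) =
      N (U (y, p y) - U (x, p x) - 'd U (x, p x) ((y, p y) - (x, p x))).
    rewrite linearB linearB /=.
    have -> : N (U (y, p y)) = N (U (x, p x)) by near: y.
    have -> : (y, p y) - (x, p x) = (y - x, 0) + (0, p y - p x).
      by congr pair; rewrite /= ?addr0 ?add0r.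
    rewrite subrr sub0r linearD linearD /=.
    have -> : N ('d U (x, p x) (0, p y - p x)) = - (p y - p x) by near: y.
    by rewrite opprD opprK addrC.
  rewrite (le_trans (NC _))// -ler_pdivlMl// mulrA [C^-1 * c]mulrC.
  have : `|U (y, p y) - U (x, p x) - 'd U (x, p x) ((y, p y) - (x, p x))| <=
      c / C * `|(y, p y) - (x, p x)|.
    by near: y; exact: (cxp _ (diff_eps dU c0')).
  move=> /le_trans; apply; rewrite ler_pM2l//.
  by rewrite ge_max /= lerDl lerDr !normr_ge0.
(* Used with [1 / 2], [key] gives the Lipschitz bound [|p y - p x| <= (2 K + 1) |y - x|]. The two
   increments then add up to at most [(2 K + 2) |y - x|], which explains the second bound on [c]. *)
move=> e e0; pose c := Num.min (1 / 2) (e / (2 * K + 2)).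
have K2 : 0 < 2 * K + 2 by rewrite addr_gt0// mulr_gt0.
have c0 : 0 < c by rewrite lt_min divr_gt0//= divr_gt0.
have := key c c0; have := key _ (divr_gt0 (@ltr01 R) (@ltr0n R 2)).
apply: filterS2 => y H1 H2; apply: (le_trans H2).
have dK : `|p y - p x| <= (2 * K + 1) * `|y - x|.
  have := LK (y - x); rewrite -/(L _) => LK'.
  have := ler_normB (p y - p x - L (y - x)) (- L (y - x)).
  rewrite opprK subrK normrN => H3; lra.
have ce : c <= e / (2 * K + 2) by rewrite ge_min lexx orbT.
apply: (@le_trans _ _ (e / (2 * K + 2) * ((2 * K + 2) * `|y - x|))).
  by rewrite ler_pM ?addr_ge0 ?(ltW c0)//; lra.
by rewrite mulrA divfK ?gt_eqF.
Unshelve. all: by end_near. Qed.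

(** Fermat's rule on the line through [x] along [v]. Maximality is asked on that line only, so that
    directions tangent to a constraint can be tested; differentiability near [x] yields derivability
    on a whole interval. *)
Lemma local_max_diff0 (V : normedModType R) (g : V -> R) x v :
    (\forall y \near x, differentiable g y) ->
    (\forall t \near (0 : R), g (x + t *: v) <= g x) ->
  'd g x v = 0.
Proof.
move=> dg gmax; pose l (t : R) := x + t *: v.
have dl t : is_diff t l ( *:%R ^~ v).
  have -> : l = cst x + ( *:%R ^~ v) by [].
  by apply: is_diff_eq; rewrite add0r.
have l0 : l 0 = x by rewrite /l scale0r addr0.
have cl : l t @[t --> 0] --> x.
  by rewrite -l0; exact: (@differentiable_continuous _ _ _ 0 l ex_diff).
have [e /= e0 eP] : \forall t \near (0 : R),
    differentiable g (l t) /\ g (l t) <= g x.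
  by apply: filterI; [exact: (cl _ dg)|exact: gmax].
have tP t : t \in `]-e, e[ -> differentiable g (l t) /\ g (l t) <= g x.
  by rewrite in_itv => te; apply: eP; rewrite /= sub0r normrN ltr_norml.
have [] := @derive1_at_max R (g \o l) (- e) e 0 _ _ _ _.
- by rewrite ge0_cp// ltW.
- move=> t /tP[dgt _]; apply: diff_derivable.
  by apply: differentiable_comp.
- by rewrite in_itv /= oppr_lt0 e0.
- by move=> t /tP[_]; rewrite /= l0.
move=> _ <-; have d0 : differentiable g (l 0) by rewrite l0; exact: nbhs_singleton dg.
rewrite deriveE; last exact: differentiable_comp.
have dl0 : 'd l 0 = ( *:%R ^~ v) :> (R -> V) by exact: diff_val.
rewrite (@diff_comp _ _ _ _ l g 0)//= dl0.
by rewrite scale1r l0.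
Qed.

End differentiation.

(** * Constrained maximizers *)

Section policy_differentiability.
Context {R : realType} {S : finType} {k : nat} {M : mdp R S k}.
Context {disp : measure_display} {Omega : measurableType disp}.
Variable Z : trajectories M Omega.
Context {V : normedModType R}.
Variables (P : V -> table R S k) (x : V).
Hypothesis P_policy : forall y, is_policy (P y).
Hypothesis P_diff : forall s, differentiable (fun y => P y s) x.

(** In [Q_difference] the coefficients depend on [P x] only and the action values of [P y] are
    bounded uniformly in [y], so the policy increments drive the difference to 0. *)
Lemma continuous_Q s a : {for x, continuous (fun y => Q Z (P y) s 0 a)}.
Proof.
pose c s' := resolvent (gamma M) (pi_kernel M (P x))
  (fun z => (z.1 == s')%:R) (s, a) - (s == s')%:R.
pose B := rmax M / (1 - gamma M).
pose e y := \sum_s' `|c s'| * \sum_b `|P y s' 0 b - P x s' 0 b| * B.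
have e0 : e y @[y --> x] --> 0.
  have <- : e x = 0.
    rewrite /e big1// => s' _; rewrite big1 ?mulr0// => b _.
    by rewrite subrr normr0 mul0r.
  apply: cvg_big => [|s' _]; first exact: add_continuous.
  apply: cvgM; first exact: cvg_cst.
  apply: cvg_big => [|b _]; first exact: add_continuous.
  apply: cvgM; last exact: cvg_cst.
  apply: cvg_norm; apply: cvgB; last exact: cvg_cst.
  exact: (differentiable_continuous (differentiable_comp_coord b (P_diff s'))).
apply/cvgrPdist_le => eps eps0; near=> y.
rewrite distrC (Q_difference Z s a (P_policy x) (P_policy y)).
apply: (@le_trans _ _ (e y)).
  rewrite (le_trans (ler_norm_sum _ _ _))//; apply: ler_sum => s' _.
  rewrite normrM ler_wpM2l// (le_trans (ler_norm_sum _ _ _))//.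
  by apply: ler_sum => b _; rewrite normrM ler_wpM2l// Q_bound.
rewrite (le_trans (ler_norm _))// -[e y]subr0 distrC.
by near: y; move/cvgrPdist_le : e0; apply.
Unshelve. all: by end_near. Qed.

(** The common core of the derivatives of [Q] and [J]: each summand of the advantage is a policy
    increment vanishing at [x] times a continuous action value, as in [is_diff_mul0]. *)
Lemma is_diff_advantage (c : S -> R) (F : V -> R) :
    (forall y, F y - F x = \sum_s c s * advantage Z (P x) (P y) s) ->
  is_diff x F (fun v => \sum_s c s * \sum_a Q Z (P x) s 0 a *
    'd (fun y => P y s 0 a) x v).
Proof.
move=> FE; pose u s a y := P y s 0 a - P x s 0 a.
have du s a : is_diff x (u s a) ('d (fun y => P y s 0 a) x).
  have dP := differentiableP (differentiable_comp_coord a (P_diff s)).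
  have -> : u s a = (fun y => P y s 0 a) - cst (P x s 0 a) by [].
  by apply: is_diff_eq; rewrite subr0.
have -> : F = cst (F x) +
    \sum_s c s *: \sum_a (u s a * (fun y => Q Z (P y) s 0 a)).
  apply/funext => y; rewrite !fctE -[F y](subrK (F x)) addrC FE; congr (_ + _).
  rewrite fct_sumE; apply: eq_bigr => s _.
  by rewrite !fctE fct_sumE.
have dterm s a : is_diff x (u s a * (fun y => Q Z (P y) s 0 a))
    (Q Z (P x) s 0 a *: ('d (u s a) x : V -> R)).
  apply: is_diff_mul0; [exact: ex_diff|exact: subrr|exact: continuous_Q].
have dsum s := is_diffZ (c s) (is_diff_sum (dterm s)).
apply: (is_diff_eq (is_diffD (is_diff_cst (F x) x) (is_diff_sum dsum))).
apply/funext => v; rewrite !fctE add0r fct_sumE; apply: eq_bigr => s _.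
rewrite !fctE fct_sumE; congr (_ * _); apply: eq_bigr => a _.
rewrite !fctE.
by have -> : 'd (u s a) x = 'd (fun y => P y s 0 a) x :> (V -> R) by exact: diff_val.
Qed.

Lemma differentiable_Q s : differentiable (fun y => Q Z (P y) s) x.
Proof.
apply: differentiable_rV => a.
have := @is_diff_advantage _ _ (fun y => Q_difference Z s a (P_policy x) (P_policy y)).
by move=> ?; exact: ex_diff.
Qed.

End policy_differentiability.

(** * Continuity and stationarity of constrained maximizers *)

Section constrained_argmax.
Context {R : realType}.
Local Open Scope ereal_scope.

(** Turns a comparison of possibly infinite objectives into a real upper bound on [d], a form suited
    to lower semicontinuity. *)
Lemma objective_le (lambda l l' : R) (d d' : \bar R) : (0 < lambda)%R ->
    d' \is a fin_num ->
  (l'%:E - lambda%:E * d' <= l%:E - lambda%:E * d) =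
  (d <= (fine d' + (l - l') / lambda)%:E).
Proof.
move=> lam0; case: d' => // r' _; case: d => [r| |].
- rewrite -!EFinM -!EFinB !lee_fin -[in RHS](ler_pM2l lam0) mulrDr.
  rewrite [(lambda * (_ / _))%R]mulrCA mulfV ?gt_eqF// mulr1 /=.
  by apply/idP/idP; lra.
- by rewrite gt0_muley ?lte_fin//= leeNy_eq leye_eq.
- by rewrite gt0_muleNy ?lte_fin//= leey leNye.
Qed.

(** Each point of [C] outside a neighborhood of [f x] is beaten by [f x], and stays beaten for
    nearby points and parameters; compactness makes this uniform. The constraint set [D] itself need
    not be compact, as the maximizers lie in [C]. *)
Lemma argmax_continuous (X : topologicalType) k (lambda : R)
    (C D : set 'rV[R]_k) (q : X -> 'rV[R]_k) (d : X -> 'rV[R]_k -> \bar R)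
    (f : X -> 'rV[R]_k) (x : X) :
    (0 < lambda)%R -> compact C -> C `<=` D -> (forall y, C (f y)) ->
    (forall y, argmax D (fun p => (\sum_a p ord0 a * q y ord0 a)%R%:E -
                                  lambda%:E * d y p) = [set f y]) ->
    {for x, continuous q} ->
    (forall p (a : R), a%:E < d x p -> \forall z \near (p, x), a%:E < d z.2 z.1) ->
    (\forall y \near x, d y (f x) \is a fin_num) ->
    {for x, continuous (fun y => fine (d y (f x)))} ->
  {for x, continuous f}.
Proof.
move=> lam0 cC CD Cf fE cq lsc dfin cd A nA.
pose l y (p : 'rV[R]_k) := (\sum_a p ord0 a * q y ord0 a)%R.
have [Df fmax] : D (f x) /\ forall p, D p ->
    (l x p)%:E - lambda%:E * d x p <= (l x (f x))%:E - lambda%:E * d x (f x).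
  by have : [set f x] (f x) by []; rewrite -fE => -[].
have nA' : nbhs (f x) A° by exact: nbhs_interior.
have cK : compact (C `&` ~` A°).
  by apply: compact_closedI => //; apply: open_closedC; exact: open_interior.
have covK := (compact_near_coveringP (C `&` ~` A°)).1 cK.
have : \forall y \near x, (C `&` ~` A°) `<=` [set p | f y <> p].
  apply: (covK X (nbhs x) (fun y p => f y <> p)) => p [Cp nAp].
  have pf : p <> f x by move=> pE; apply: nAp; rewrite pE; exact: nbhs_singleton nA'.
  (* By [objective_le], [p'] does at least as well as [f x] at [y] exactly when
     [d y p' <= b y p']. *)
  pose b y p' := (fine (d y (f x)) + (l y p' - l y (f x)) / lambda)%R.
  (* Otherwise [p] would be a second maximizer at [x]. *)
  have dp : (b x p)%:E < d x p.
    rewrite ltNge; apply/negP; rewrite -objective_le//; last exact: nbhs_singleton dfin.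
    move=> H; apply: pf; have : [set f x] p; last by [].
    rewrite -fE; split=> [|p' Dp']; first exact: CD.
    by apply: le_trans H; exact: fmax.
  (* A real number strictly between the two: [b] stays below it by continuity and [d] above it by
     lower semicontinuity. *)
  have [a ba da] : exists2 a : R, (b x p < a)%R & a%:E < d x p.
    move: dp; case: (d x p) => [r| |] //.
      rewrite lte_fin => br; exists ((b x p + r) / 2)%R; first by rewrite midf_lt.
      by rewrite lte_fin midf_lt.
    by move=> _; exists (b x p + 1)%R; [rewrite ltrDl|rewrite ltry].
  have cl : {for (p, x), continuous (fun z : 'rV[R]_k * X => b z.2 z.1)}.
    have cq2 : q z.2 @[z --> (p, x)] --> q x.
      by apply: (cvg_comp _ q); [exact: cvg_snd|exact: cq].
    have cqa e : q z.2 ord0 e @[z --> (p, x)] --> q x ord0 e.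
      apply: (cvg_comp (fun z : 'rV[R]_k * X => q z.2)
        (fun w : 'rV[R]_k => w ord0 e)); first exact: cq2.
      exact: continuous_coord_rV.
    have cpa e : (fun z : 'rV[R]_k * X => z.1 ord0 e) @ (p, x) --> p ord0 e.
      apply: (cvg_comp (fun z : 'rV[R]_k * X => z.1)
        (fun w : 'rV[R]_k => w ord0 e)); first exact: cvg_fst.
      exact: continuous_coord_rV.
    apply: cvgD.
      by apply: (cvg_comp _ (fun y => fine (d y (f x)))); [exact: cvg_snd|exact: cd].
    apply: cvgM; last exact: cvg_cst.
    apply: cvgB; apply: cvg_big => [|e _]; try exact: add_continuous.
      by apply: cvgM.
    by apply: cvgM => //; exact: cvg_cst.
  have near1 : \forall z \near (p, x), (b z.2 z.1 < a)%R by exact: (cvgr_lt _ cl).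
  have near2 : \forall z \near (p, x), a%:E < d z.2 z.1 by exact: lsc.
  have near3 : \forall z \near (p, x), d z.2 (f x) \is a fin_num.
    have : (z.2 @[z --> (p, x)]) --> x by exact: cvg_snd.
    by move=> /(_ _ dfin).
  apply: filterS3 near1 near2 near3 => -[p' y] /= bp' dp' dfy fy.
  have [_ /(_ (f x) Df)] : argmax D (fun p => (l y p)%:E - lambda%:E * d y p) (f y).
    by rewrite [argmax _ _]fE.
  rewrite objective_le// fy => /(lt_le_trans dp'); rewrite lte_fin.
  by move=> /(lt_trans bp'); rewrite ltxx.
apply: filterS => y KP; apply: contrapT => nAf; apply: (KP (f y)) => //; split=> //.
by move=> /interior_subset.
Qed.

(** The Lagrange condition, with [c] as multiplier. Zero-sum vectors are the directions tangent to
    [sum_one], and along them the derivative of the objective vanishes. *)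
Lemma argmax_stationary k (lambda : R) (q : 'rV[R]_k) (d : 'rV[R]_k -> \bar R) p :
    (0 < lambda)%R ->
    argmax sum_one (fun p => (\sum_a p ord0 a * q ord0 a)%R%:E - lambda%:E * d p) p ->
    (\forall p' \near p, d p' \is a fin_num) ->
    (\forall p' \near p, differentiable (fun p => fine (d p)) p') ->
  exists c : R, (q - lambda *: grad (fun p => fine (d p)) p)%R = const_mx c.
Proof.
move=> lam0 [p1 pmax] dfin ddiff; pose g p := fine (d p).
pose l (p' : 'rV[R]_k) := (\sum_a p' ord0 a * q ord0 a)%R.
have dl : linear l.
  move=> c u v; rewrite /l scaler_sumr -big_split /=; apply: eq_bigr => a _.
  by rewrite !mxE /GRing.scale /=; ring.
pose L : {linear 'rV[R]_k -> R} := HB.pack l (GRing.isLinear.Build _ _ _ _ l dl).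
have cL : continuous L.
  move=> v; suff : l u @[u --> v] --> l v by [].
  apply: (@cvg_big _ _ _ _ _ (@add_continuous R) _ (nbhs v) _ _ _ (nbhs_filter v)) => a _.
  apply: (@cvgM _ _ (nbhs v) (nbhs_filter v)); last exact: cvg_cst.
  exact: continuous_coord_rV.
pose obj := ((L : 'rV[R]_k -> R) - lambda *: g)%R.
have dobj p' : differentiable g p' -> 
    is_diff p' obj ((L : 'rV[R]_k -> R) - lambda *: ('d g p' : 'rV[R]_k -> R))%R.
  move=> dg; have dgP := differentiableP dg.
  have dLP : is_diff p' L L.
    by apply: DiffDef; [exact: linear_differentiable|exact: diff_lin].
  exact: is_diffB.
have dg := nbhs_singleton ddiff.
have stat (v : 'rV[R]_k) : (\sum_a v ord0 a = 0)%R -> L v = (lambda * 'd g p v)%R.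
  move=> v0; apply/eqP; rewrite -subr_eq0; apply/eqP.
  have <- : 'd obj p v = (L v - lambda * 'd g p v)%R.
    have dobjp := dobj p dg.
    by rewrite [LHS](congr1 (@^~ v) (diff_val (is_diff_def := dobjp))).
  apply: local_max_diff0.
    by apply: filterS ddiff => p' dg'; have ? := dobj _ dg'; exact: ex_diff.
  have cline : (p + t *: v)%R @[t --> (0%R : R)] --> p.
    rewrite -[X in _ --> X]addr0 -(scale0r v); apply: cvgD; first exact: cvg_cst.
    by apply: cvgZr_tmp; exact: cvg_id.
  have dline : \forall t \near (0%R : R), d (p + t *: v)%R \is a fin_num.
    exact: (cline _ dfin).
  apply: filterS dline => t dt.
  have pt1 : sum_one (p + t *: v)%R.
    rewrite /sum_one /=; under eq_bigr do rewrite !mxE.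
    by rewrite big_split /= -mulr_sumr v0 mulr0 addr0.
  have := pmax _ pt1; rewrite objective_le// -(fineK (nbhs_singleton dfin)) lee_fin.
  rewrite -(ler_pM2l lam0) mulrDr [(lambda * (_ / _))%R]mulrCA mulfV ?gt_eqF// mulr1.
  rewrite -/(l _) -/(l _) /obj !fctE -/(g _) -/(g _) /GRing.scale /=; lra.
pose w := (q - lambda *: grad g p)%R.
have sum_delta (h : 'I_k -> R) a : (\sum_c (delta_mx 0 a : 'rV[R]_k) ord0 c * h c = h a)%R.
  rewrite (bigD1 a)//= mxE !eqxx mul1r big1 ?addr0// => c /negPf ca.
  by rewrite mxE ca andbF mul0r.
have wE a b : w ord0 a = w ord0 b.
  (* The difference of two basis vectors is tangent, so testing on it equates two coordinates of
     [w]. *)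
  have sumab : (\sum_c (delta_mx 0 a - delta_mx 0 b : 'rV[R]_k) ord0 c = 0)%R.
    rewrite (eq_bigr (fun c => (delta_mx 0 a : 'rV[R]_k) ord0 c * 1 -
        (delta_mx 0 b : 'rV[R]_k) ord0 c * 1)%R).
      by rewrite sumrB !(sum_delta (fun=> 1%R)) subrr.
    by move=> c _; rewrite !mulr1 !mxE.
  have := stat _ sumab; rewrite !linearB /= /l !sum_delta.
  rewrite !mxE !deriveE//; lra.
(* With no action at all there is no coordinate to compare, and any constant works. *)
have [a _|none] := pickP (@predT 'I_k).
  by exists (w ord0 a); apply/rowP => b; rewrite [RHS]mxE; exact: wE.
by exists 0%R; apply/rowP => b; have := none b.
Qed.

End constrained_argmax.

(** * Algebra of the constrained inverse *)

Section constrained_inverse.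
Context {R : realType} {k : nat} (M : 'M[R]_k).
Hypothesis M_unit : M \in unitmx.
Hypothesis M_ones : ones_form M != 0.

(** On [ones], the rank-one correction produces [ones_form M] times [invmx M *m ones k], and the
    scalar cancels. *)
Lemma constrained_inv_ones : constrained_inv M *m ones k = 0.
Proof.
rewrite /constrained_inv mulmxBl -scalemxAl -!mulmxA.
have -> : (ones k)^T *m (invmx M *m ones k) = (ones_form M)%:M.
  by rewrite mulmxA; exact: mx11_scalar.
by rewrite mul_mx_scalar -scalemxAr scalerA mulVf// scale1r subrr.
Qed.

(** Stated on row vectors, hence the transposes. After [invmx M] cancels [M], the correction only
    sees the sum of the entries of [w], which is zero. *)
Lemma constrained_invK (w : 'rV[R]_k) : \sum_a w 0 a = 0 ->
  w *m M^T *m (constrained_inv M)^T = w.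
Proof.
move=> w0; apply: trmx_inj; rewrite !trmx_mul !trmxK mulmxA.
rewrite /constrained_inv mulmxBl mulVmx// -scalemxAl mulmxKV// mulmxBl mul1mx.
rewrite -scalemxAl -!mulmxA (_ : (ones k)^T *m w^T = 0) ?mulmx0 ?scaler0 ?subr0//.
apply/matrixP => i j; rewrite !mxE -[RHS]w0; apply: eq_bigr => a _.
by rewrite !mxE mul1r [j]ord1.
Qed.

End constrained_inverse.

(** * Differentiability of the constrained maximizer *)

Section argmax_differentiable.
Context {R : realType}.

Lemma continuous_pair (X Y Z : topologicalType) (f : X -> Y) (h : X -> Z) x :
  {for x, continuous f} -> {for x, continuous h} ->
  {for x, continuous (fun y => (f y, h y))}.
Proof. exact: cvg_pair. Qed.

Lemma differentiable_mulmxr k n (A : 'M[R]_(k, n)) (v : 'rV[R]_k) :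
  differentiable (fun w : 'rV[R]_k => w *m A) v.
Proof.
apply: differentiable_rV => b.
rewrite (_ : (fun w => _) = \sum_a (A a b *: (fun w : 'rV[R]_k => w 0 a))).
  by apply: differentiable_sum => a; apply: differentiableZ; exact: differentiable_coord.
apply/funext => w; rewrite fct_sumE mxE; apply: eq_bigr => a _.
by rewrite mulrC.
Qed.

(** The simplex is the intersection of the unit cube with a closed hyperplane. *)
Lemma simplex_compact k : compact [set p : 'rV[R]_k | is_dist (p 0)].
Proof.
have -> : [set p : 'rV[R]_k | is_dist (p 0)] =
    [set p : 'rV[R]_k | forall a, `[0, 1]%classic (p ord0 a)] `&` sum_one.
  apply/seteqP; split=> [p [p0 p1]|p [p01 p1]]; last first.
    by split=> // a; have := p01 a; rewrite /= in_itv /= => /andP[].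
  split=> // a; rewrite /= in_itv /= p0 -p1 (bigD1 a)//= lerDl.
  by apply: sumr_ge0.
apply: compact_closedI.
  exact: (@rV_compact R k (fun=> `[0 : R, 1]%classic) (fun=> @segment_compact R 0 1)).
have -> : @sum_one R k = (fun p : 'rV[R]_k => (p *m (ones k)) 0 0) @^-1` [set 1].
  apply/seteqP; split=> p; rewrite /= /sum_one /= mxE => <-;
    by apply: eq_bigr => a _; rewrite mxE mulr1.
apply: closed_comp; last exact: closed_eq.
move=> p _; apply: differentiable_continuous.
exact: (differentiable_comp_coord 0 (differentiable_mulmxr _ _)).
Qed.

(** An instance of [implicit_is_diff]: [U] is the gradient in [p] of the objective, and [N] is the
    constrained inverse acting on row vectors, which removes the unknown multiplier. *)
Lemma constrained_argmax_is_diff m k (lambda : R) (q : 'rV[R]_m -> 'rV[R]_k)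
    (d : 'rV[R]_m -> 'rV[R]_k -> \bar R) (f : 'rV[R]_m -> 'rV[R]_k)
    (x : 'rV[R]_m) (M : 'M[R]_k) :
    let g y p := fine (d y p) in
    0 < lambda -> (forall y, is_dist (f y 0)) ->
    (forall y, argmax sum_one (fun p => ((\sum_a p 0 a * q y 0 a)%:E -
                                         lambda%:E * d y p)%E) = [set f y]) ->
    differentiable q x ->
    (forall p (a : R), (a%:E < d x p)%E ->
       \forall z \near (p, x), (a%:E < d z.2 z.1)%E) ->
    (\forall z \near (x, f x), d z.1 z.2 \is a fin_num) ->
    {for (x, f x), continuous (fun z : 'rV[R]_m * 'rV[R]_k => g z.1 z.2)} ->
    (\forall z \near (x, f x), differentiable (g z.1) z.2) ->
    differentiable (fun z : 'rV[R]_m * 'rV[R]_k => grad (g z.1) z.2) (x, f x) ->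
    M = lambda *: hess (g x) (f x) -> M \in unitmx -> ones_form M != 0 ->
  is_diff x f (fun v =>
    ('d q x v - lambda *: 'd (fun y => grad (g y) (f x)) x v) *m
    (constrained_inv M)^T).
Proof.
move=> g lam0 f_dist fE dq lsc dfin dcont ddiff dgrad ME M_unit M_ones.
have cpair : {for x, continuous (fun y => (y, f x))}.
  by apply: continuous_pair; [by move=> A|exact: cst_continuous].
have cf : {for x, continuous f}.
  apply: (@argmax_continuous R _ k lambda _ sum_one q d f x lam0
    (@simplex_compact k)) => //.
  - by move=> p [].
  - exact: differentiable_continuous.
  - exact: (cpair _ dfin).
  - exact: (@continuous_comp _ _ _ (fun y => (y, f x))
      (fun z : 'rV[R]_m * 'rV[R]_k => g z.1 z.2) x cpair dcont).
have cpair' : {for x, continuous (fun y => (y, f y))}.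
  by apply: continuous_pair; [by move=> A|exact: cf].
pose N := mulmxr (constrained_inv M)^T : {linear 'rV[R]_k -> 'rV[R]_k}.
have cN : continuous N.
  by move=> w; apply: differentiable_continuous; exact: differentiable_mulmxr.
have N_const c : N (const_mx c) = 0.
  have -> : const_mx c = c *: (ones k)^T by apply/rowP => a; rewrite !mxE mulr1.
  by rewrite linearZ /= -trmx_mul constrained_inv_ones// trmx0 scaler0.
pose U (z : 'rV[R]_m * 'rV[R]_k) := q z.1 - lambda *: grad (g z.1) z.2.
have NU : \forall y \near x, N (U (y, f y)) = 0.
  (* Stationarity at [y] needs finiteness and differentiability on a neighborhood of [f y], so
     interiors are pulled back along [y |-> (y, f y)]. *)
  have ndfin := cpair' _ (nbhs_interior dfin).
  have nddiff := cpair' _ (nbhs_interior ddiff).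
  apply: (@filterS2 _ (nbhs x) (nbhs_filter x) _ _ _ _ nddiff ndfin) => y ddy dfy.
  have cy : {for f y, continuous (fun p => (y, p))}.
    by apply: continuous_pair; [exact: cst_continuous|by move=> A].
  have fy : argmax sum_one (fun p => ((\sum_a p 0 a * q y 0 a)%:E -
      lambda%:E * d y p)%E) (f y) by rewrite fE.
  have [c Uc] := argmax_stationary lam0 fy (cy _ dfy) (cy _ ddy).
  by rewrite (Uc : U (y, f y) = const_mx c) N_const.
pose G := fun z : 'rV[R]_m * 'rV[R]_k => grad (g z.1) z.2.
have dUE : is_diff (x, f x) U (fun z => 'd q x z.1 - lambda *: 'd G (x, f x) z).
  have dfst : is_diff (x, f x) (fst : 'rV[R]_m * 'rV[R]_k -> 'rV[R]_m) fst.
    have cfst : continuous (fst : 'rV[R]_m * 'rV[R]_k -> 'rV[R]_m).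
      by move=> z; exact: cvg_fst.
    by apply: DiffDef; [exact: linear_differentiable|exact: diff_lin].
  have dqP := differentiableP dq; have dGP := differentiableP dgrad.
  have -> : U = (q \o fst) - lambda *: G by [].
  apply: is_diffB; apply: is_diff_eq; reflexivity.
have dU : 'd U (x, f x) = (fun z => 'd q x z.1 - lambda *: 'd G (x, f x) z) :> (_ -> _).
  exact: diff_val.
(* The two partial differentials of the gradient are restrictions of its joint differential; this
   one, in the parameter, is the mixed second derivative. *)
have dG1 v : 'd (fun y => grad (g y) (f x)) x v = 'd G (x, f x) (v, 0).
  have dp : is_diff x (fun y : 'rV[R]_m => (y, f x)) (fun v => (v, 0)).
    by apply: is_diff_pair.
  have -> : (fun y => grad (g y) (f x)) = G \o (fun y => (y, f x)) by [].
  rewrite diff_comp//=.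
  by have -> : 'd (fun y : 'rV[R]_m => (y, f x)) x =
    (fun v => (v, 0)) :> (_ -> _) by exact: diff_val.
(* The partial differential in [p] is the Hessian, transposed because it acts on row vectors from
   the right. *)
have dG2 w : lambda *: 'd G (x, f x) (0, w) = w *m M^T.
  have dp : is_diff (f x) (fun p : 'rV[R]_k => (x, p)) (fun v => (0, v)).
    by apply: is_diff_pair.
  rewrite ME linearZ /= -scalemxAr /hess /jac trmxK /jacobian mul_rV_lin1; congr (_ *: _).
  have -> : grad (g x) = G \o (fun p => (x, p)) by [].
  rewrite diff_comp//=.
  by have -> : 'd (fun p : 'rV[R]_k => (x, p)) (f x) =
    (fun v => (0, v)) :> (_ -> _) by exact: diff_val.
have := @implicit_is_diff _ _ _ _ f U N x cN cf _ _ _.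
set df := (fun v : 'rV[R]_m => _); move=> H.
apply: is_diff_eq; first apply: H.
- by have := dUE => ?; exact: ex_diff.
- have NU0 := nbhs_singleton NU.
  by move: NU; apply: filterS => y NUy; exact: etrans NUy (esym NU0).
(* Both [f y] and [f x] have sum 1, so their difference has zero sum and [constrained_invK] applies;
   the sign comes from [- lambda] in [U]. *)
- near=> y.
  rewrite dU /= linear0 sub0r mulNmx dG2 constrained_invK//.
  by under eq_bigr do rewrite !mxE; rewrite sumrB (f_dist y).2 (f_dist x).2 subrr.
apply/funext => v; rewrite /df dU /= -dG1.
by [].
Unshelve. all: by end_near. Qed.

End argmax_differentiable.

(** * The meta-gradient formula *)

Theorem proposition1 (R : realType) (S : finType) (k : nat) (tau : mdp R S k)
    (disp : measure_display) (Omega : measurableType disp)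
    (Z : trajectories tau Omega)
    (dsq : 'rV[R]_k -> 'rV[R]_k -> \bar R) (lambda : R)
    (dsq_ge0 : forall q p : 'rV[R]_k,
      is_dist (q 0) -> is_dist (p 0) -> (0 <= dsq q p)%E)
    (dsq_lsc : lower_semicontinuous
      (fun x : 'rV[R]_k * 'rV[R]_k => dsq x.1 x.2))
    (lambda_gt0 : 0 < lambda)
    (m : nat) (pol : 'rV[R]_m -> table R S k)
    (pol_policy : forall phi, is_policy (pol phi))
    (pol_differentiable : forall s phi,
      differentiable (fun phi' => pol phi' s) phi)
    (alg : table R S k -> table R S k)
    (algE : forall phi s,
      argmax sum_one (objective Z dsq lambda (pol phi) s)
        = [set alg (pol phi) s])
    (alg_policy : forall phi, is_policy (alg (pol phi)))
    (phi : 'rV[R]_m)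
    (dsq_smooth : forall s,
      twice_differentiable_at dsq pol s phi (alg (pol phi) s))
    (M : S -> 'M[R]_k)
    (ME : forall s,
      M s = lambda *: hess (dsq_param dsq pol s phi) (alg (pol phi) s))
    (M_unit : forall s, M s \in unitmx)
    (M_ones : forall s, ones_form (M s) != 0) :
  let theta' := alg (pol phi) in
  [/\ (forall s, differentiable (fun phi' => alg (pol phi') s) phi) /\
      (forall s, differentiable (fun phi' => Q Z (pol phi') s) phi),
      differentiable (fun phi' => J Z (alg (pol phi'))) phi,
      grad (fun phi' => J Z (alg (pol phi'))) phi =
        (1 - gamma tau)^-1 *: \sum_s visit Z theta' s *:
          \sum_a Q Z theta' s 0 a *:
            grad (fun phi' => alg (pol phi') s 0 a) phi
    & forall s,
        jac (fun phi' => alg (pol phi') s) phi =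
          constrained_inv (M s) *m
          (jac (fun phi' => Q Z (pol phi') s) phi -
           lambda *: jac (fun phi' => grad (dsq_param dsq pol s phi') (theta' s))
                       phi)].
Proof.
move=> theta'.
have dQ s : differentiable (fun phi' => Q Z (pol phi') s) phi.
  by apply: differentiable_Q => // s'; exact: pol_differentiable.
have dalg s : is_diff phi (fun phi' => alg (pol phi') s) (fun v =>
    ('d (fun phi' => Q Z (pol phi') s) phi v - lambda *:
     'd (fun phi' => grad (dsq_param dsq pol s phi') (theta' s)) phi v) *m
    (constrained_inv (M s))^T).
  have [fin_near cont diff_near grad_diff] := dsq_smooth s.
  apply: (@constrained_argmax_is_diff R m k lambda (fun phi' => Q Z (pol phi') s)
    (fun phi' => dsq (pol phi' s)) (fun phi' => alg (pol phi') s) phi (M s)) => //.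
  - by move=> y; exact: alg_policy.
  - by move=> y; exact: algE.
  (* Joint lower semicontinuity in the two distributions is transported to the parameter through the
     continuous map [phi |-> pol phi s]. *)
  - move=> p a lta; have [W nW aW] := dsq_lsc (pol phi s, p) a lta.
    have cW : {for (p, phi), continuous (fun z => (pol z.2 s, z.1))}.
      apply: continuous_pair; last exact: cvg_fst.
      apply: (cvg_comp _ (fun y => pol y s)); first exact: cvg_snd.
      exact: (differentiable_continuous (pol_differentiable s phi)).
    exact: filterS (fun z => aW (pol z.2 s, z.1)) (cW _ nW).
have dalg' s : differentiable (fun phi' => alg (pol phi') s) phi.
  by have := dalg s => ?; exact: ex_diff.
have J_diff y : J Z (alg (pol y)) - J Z theta' =
    \sum_s ((1 - gamma tau)^-1 * visit Z theta' s) *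
      advantage Z theta' (alg (pol y)) s.
  rewrite (J_difference Z (alg_policy phi) (alg_policy y)) mulr_sumr.
  by apply: eq_bigr => s _; rewrite mulrA.
have dJ := is_diff_advantage (P := fun y => alg (pol y))
  (F := fun y => J Z (alg (pol y))) alg_policy dalg' J_diff.
have dJ' : differentiable (fun y => J Z (alg (pol y))) phi by exact: ex_diff.
split=> //.
- apply/rowP => j; rewrite !mxE deriveE//.
  rewrite (congr1 (@^~ _) (diff_val (is_diff_def := dJ))) /= summxE mulr_sumr.
  apply: eq_bigr => s _; rewrite mxE summxE -mulrA; congr (_ * (_ * _)).
  apply: eq_bigr => a _; rewrite !mxE deriveE//.
  exact: differentiable_comp_coord.
(* Transposing returns to the row-vector convention of ['J], where the matrix identity is checked
   row by row, on basis vectors. *)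
- move=> s; apply: trmx_inj; rewrite trmx_mul /jac trmxK.
  have trE (A B : 'M[R]_(m, k)) : (A^T - lambda *: B^T)^T = A - lambda *: B.
    by apply/matrixP => i j; rewrite !mxE.
  have mulJ (g h : 'rV[R]_m -> 'rV[R]_k) v :
      v *m ('J g phi - lambda *: 'J h phi) = 'd g phi v - lambda *: 'd h phi v.
    by rewrite mulmxBr -scalemxAr; congr (_ - _ *: _); exact: mul_rV_lin1.
  have dalgE v : 'd (fun phi' => alg (pol phi') s) phi v =
      v *m ('J (fun phi' => Q Z (pol phi') s) phi - lambda *:
            'J (fun phi' => grad (dsq_param dsq pol s phi') (theta' s)) phi) *m
      (constrained_inv (M s))^T.
    rewrite mulJ.
    have dE := congr1 (@^~ v) (diff_val (is_diff_def := dalg s)).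
    exact: dE.
  rewrite trE; apply/row_matrixP => i; rewrite !rowE mulmxA -dalgE.
  exact: mul_rV_lin1.
Qed.
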